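(* Let $A$ be an $n\times n$ matrix with entries in $\{0,1\}$ and with $\mathrm{per}(A)\neq0$, and let $r_i\neq0$ be the number of ones in the $i$-th row of $A$ ($i=1,\ldots,n$). Then for all $\alpha\in(0,1)$, $$-\ln_\alpha\left(\frac{1}{\mathrm{per}(A)}\right)\leq\sum_{i=1}^n\frac{1}{r_i}\sum_{j=1}^{r_i}\ln_\alpha(j).$$
   Context: The permanent of an $n\times n$ matrix $A=[a(i,j)]$ is $\mathrm{per}(A)=\sum_{\sigma\in S_n}\prod_{i=1}^n a(i,\sigma(i))$, where $S_n$ is the set of all permutations of $\{1,\ldots,n\}$. For $\xi>0$ and $\alpha>0$, $\alpha\neq1$, the $\alpha$-logarithm is $\ln_\alpha(\xi)=\frac{\xi^{1-\alpha}-1}{1-\alpha}$. *)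

(* Defs.v *)
From mathcomp Require Import all_boot all_order all_fingroup all_algebra.
From mathcomp Require Import all_classical all_reals all_analysis.

Set Implicit Arguments.
Unset Strict Implicit.
Unset Printing Implicit Defensive.

Import Order.TTheory GRing.Theory Num.Theory.

Local Open Scope ring_scope.

Definition permanent (R : comPzRingType) (n : nat) (A : 'M[R]_n) : R :=
  \sum_(s : 'S_n) \prod_(i < n) A i (s i).

(* Meaningful for 0 < xi, 0 < alpha and alpha != 1. *)
Definition alpha_ln (R : realType) (alpha xi : R) : R :=
  (xi `^ (1 - alpha) - 1) / (1 - alpha).

Definition row_ones (R : pzRingType) (n : nat) (A : 'M[R]_n) (i : 'I_n) : nat :=
  #|[set j : 'I_n | A i j == 1]|.

(* Main.v *)
Require Import Defs.
From mathcomp Require Import all_boot all_order all_fingroup all_algebra.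
From mathcomp Require Import all_classical all_reals all_analysis.

(** Because [ln x <= alpha_ln alpha x] for every [x > 0] (this is
    [1 + t <= expR t] at [t = (1 - alpha) * ln x]), the left-hand side is at
    most [ln (permanent A)] and the right-hand side is at least
    [\sum_i 1 / r_i * \sum_(1 <= j < r_i.+1) ln j].  Hence it is enough to prove
    Bregman's theorem [per A <= \prod_i (r_i`!) `^ (1 / r_i)] in logarithmic
    form; nothing is lost, since Bregman's theorem is the limit of the claim as
    [alpha] tends to 1.

    The proof of Bregman's theorem follows Schrijver.  Let [S] be the set of
    permutations supported by the ones of [A], and [N] its cardinal.  Expanding
    along row [i] splits [S] into at most [r_i] fibres, according to the value
    at [i], and concavity of the logarithm ([card_ln_fibers]) gives
      [N * ln N <= N * ln r_i + \sum_(s in S) ln m_i(s)],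
    with [m_i(s)] the size of the fibre of [s], that is, the permanent of the
    minor at [(i, s i)].  The minor is bounded by induction.  Deleting column
    [s i] lowers [r_j] by one exactly when [A j (s i) = 1], so that, after
    summation over [i] with [s] fixed, row [j] meets [r_j - 1] times the
    average of the first [r_j - 1] logarithms and [n - r_j] times the average
    of the first [r_j].  Together with [ln r_j] this amounts to [n] times the
    latter ([mean_ln_minors]), and dividing by [n * N] ends the induction.

    To avoid minors of varying size, the induction does not delete rows and
    columns: it freezes a permutation [s0] outside a set [I] of rows, which
    leaves the columns [s0 @: I] for the rows in [I].  Taking the minor at
    [(i, s i)] is then replacing [I] by [I :\ i] and [s0] by [s]. *)

Set Implicit Arguments.
Unset Strict Implicit.
Unset Printing Implicit Defensive.

Import Order.TTheory GRing.Theory Num.Theory.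

Local Open Scope ring_scope.

(** * Averages of logarithms *)

Definition mean_ln (R : realType) (r : nat) : R :=
  1 / r%:R * \sum_(1 <= j < r.+1) ln j%:R.

Lemma mulr_mean_ln (R : realType) (r : nat) :
  r%:R * mean_ln R r = \sum_(1 <= j < r.+1) ln j%:R.
Proof.
rewrite /mean_ln; case: r => [|r]; first by rewrite mul0r big_geq.
by rewrite mulrA mul1r divff ?mul1r // pnatr_eq0.
Qed.

Lemma mulr_mean_lnS (R : realType) (r : nat) :
  r.+1%:R * mean_ln R r.+1 = r%:R * mean_ln R r + ln r.+1%:R.
Proof. by rewrite !mulr_mean_ln big_nat_recr. Qed.

(** By concavity of the logarithm, in the form of its tangent at 1: the ratio
    [#|A| / (#|K| * m s)], with [m s] the size of the fibre of [s], has mean at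
    most 1 over [A], because the reciprocals of [m] add up to 1 on each of the
    at most [#|K|] fibres. *)
Lemma card_ln_fibers (R : realType) (S T : finType) (A : {set S}) (K : {set T})
    (f : S -> T) (fAK : forall s, s \in A -> f s \in K) :
  #|A|%:R * ln #|A|%:R <=
    #|A|%:R * ln #|K|%:R
    + \sum_(s in A) ln (#|[set t in A | f t == f s]|%:R : R) :> R.
Proof.
have [->|[s0 s0A]] := set_0Vmem A; first by rewrite cards0 !mul0r big_set0 addr0.
have A_gt0 : 0 < #|A|%:R :> R by rewrite ltr0n; apply/card_gt0P; exists s0.
have K_gt0 : 0 < #|K|%:R :> R.
  by rewrite ltr0n; apply/card_gt0P; exists (f s0); apply: fAK.
pose m k : R := #|[set t in A | f t == k]|%:R.
have m_gt0 s : s \in A -> 0 < m (f s).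
  by move=> sA; rewrite ltr0n; apply/card_gt0P; exists s; rewrite inE sA eqxx.
have inv_m : \sum_(s in A) (m (f s))^-1 <= #|K|%:R.
  rewrite (partition_big f (mem K)) //= -sumr_const.
  apply: ler_sum => k _.
  rewrite (eq_bigr (fun=> (m k)^-1)); last by move=> s /andP[_ /eqP ->].
  rewrite (eq_bigl (mem [set t in A | f t == k])); last first.
    by move=> s; rewrite /= inE.
  rewrite sumr_const -mulr_natl -/(m k).
  by have [->|mk] := eqVneq (m k) 0; rewrite ?mul0r // divff.
have tangent s : s \in A ->
  ln #|A|%:R <= ln #|K|%:R + ln (m (f s))
                + (#|A|%:R / #|K|%:R * (m (f s))^-1 - 1).
  move=> sA; have m0 := m_gt0 s sA.
  rewrite -lnM ?posrE // -lerBlDl -ln_div ?posrE ?mulr_gt0 //.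
  rewrite invfM mulrA.
  have x_gt0 : 0 < #|A|%:R / #|K|%:R / m (f s) by rewrite !divr_gt0.
  have := expR_ge1Dx (ln (#|A|%:R / #|K|%:R / m (f s))).
  by rewrite lnK ?posrE // -lerBrDl.
rewrite !mulr_natl -[leLHS]sumr_const -[X in _ <= X + _]sumr_const -big_split /=.
apply: le_trans (ler_sum _ tangent) _.
rewrite big_split /= -[leRHS]addr0 lerD2l sumrB -mulr_sumr sumr_const subr_le0.
apply: le_trans (ler_wpM2l _ inv_m) _; first by rewrite divr_ge0 // ltW.
by rewrite divfK // gt_eqF.
Qed.

(** * Permutations supported by a relation *)

(** The perfect matchings of the minor with rows [I] and columns [s0 @: I]. *)
Definition matchings (T : finType) (a : rel T) (I : {set T}) (s0 : {perm T}) :=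
  [set s : {perm T} |
    [forall x, if x \in I then a x (s x) else s x == s0 x]].

(** The number of ones in row [x] of that minor, its columns being indexed by
    their preimages in [I]. *)
Definition degree (T : finType) (a : rel T) (I : {set T}) (s0 : {perm T})
    (x : T) : nat :=
  #|[set y in I | a x (s0 y)]|.

Section Matchings.
Variables (T : finType) (a : rel T).
Implicit Types (I : {set T}) (s t : {perm T}).

Lemma matchingsP I s0 s :
  reflect ((forall x, x \in I -> a x (s x)) /\
           (forall x, x \notin I -> s x = s0 x))
          (s \in matchings a I s0).
Proof.
rewrite inE; apply: (iffP forallP) => [H|[H1 H2] x].
  split=> x xI; have := H x; first by rewrite xI.
  by rewrite (negbTE xI) => /eqP.
by case: ifPn => [/H1|/H2 ->].
Qed.

Lemma matchings_imset I s0 s : s \in matchings a I s0 -> s @: I = s0 @: I.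
Proof.
move=> /matchingsP[_ eq_s]; apply/setP => z; rewrite -!preim_permV !inE.
apply/idP/idP; apply: contraLR => zI; have := eq_s _ zI; rewrite permKV.
  by move=> /esym/(canLR (permK s)) ->.
by move=> /(canLR (permK s0)) ->.
Qed.

Lemma degree_imset I s x : degree a I s x = #|[set z in s @: I | a x z]|.
Proof.
rewrite /degree -(card_imset _ (@perm_inj _ s)); congr #|pred_of_set _|.
apply/setP => z; rewrite !inE; apply/imsetP/andP.
  by case=> y; rewrite inE => /andP[yI axy] ->; rewrite imset_f.
by case=> /imsetP[y yI ->] axy; exists y; rewrite // inE yI.
Qed.

Lemma degree_matchings I s0 s x :
  s \in matchings a I s0 -> degree a I s x = degree a I s0 x.
Proof. by move=> sM; rewrite !degree_imset (matchings_imset sM). Qed.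

Lemma degreeD1 I s x y : y \in I ->
  degree a I s x = (a x (s y) + degree a (I :\ y) s x)%N.
Proof.
move=> yI; rewrite /degree (cardsD1 y) inE yI /=; congr (_ + #|pred_of_set _|)%N.
by apply/setP => z; rewrite !inE andbA.
Qed.

(** Fixing the value at [x] amounts to passing to a minor. *)
Lemma matchings_fiber I s0 s x : x \in I -> s \in matchings a I s0 ->
  [set t in matchings a I s0 | t x == s x] = matchings a (I :\ x) s.
Proof.
move=> xI /matchingsP[as_ eq_s]; apply/setP => t; rewrite inE.
apply/andP/matchingsP => [[/matchingsP[at_ eq_t] /eqP tx]|[at_ eq_t]].
  split=> y; rewrite !inE; first by case/andP=> _ /at_.
  rewrite negb_and negbK => /predU1P[-> //|yI].
  by rewrite eq_t // eq_s.
have tx : t x = s x by apply: eq_t; rewrite !inE eqxx.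
split; last exact/eqP.
apply/matchingsP; split=> y yI; last first.
  by rewrite eq_t ?eq_s // !inE (negbTE yI) andbF.
have [->|yx] := eqVneq y x; first by rewrite tx as_.
by apply: at_; rewrite !inE yx.
Qed.

Lemma matchings_refl I s0 s : s \in matchings a I s0 -> s \in matchings a I s.
Proof. by case/matchingsP=> as_ _; apply/matchingsP. Qed.

(** In row [j] of degree [d], the [d - 1] ones other than [s j] lie in columns
    whose deletion leaves degree [d - 1], and the other [#|I| - d] deletions
    leave [d]; the recursion for [d * mean_ln d] absorbs [ln d]. *)
Lemma mean_ln_minors (R : realType) I s : s \in matchings a I s ->
  \sum_(i in I) (ln (degree a I s i)%:R
                 + \sum_(j in I :\ i) mean_ln R (degree a (I :\ i) s j))
  = #|I|%:R * \sum_(j in I) mean_ln R (degree a I s j).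
Proof.
case/matchingsP=> as_ _; rewrite big_split /=.
rewrite (exchange_big_dep (mem I)) /=; last by move=> i j _ /setD1P[].
rewrite -big_split mulr_sumr; apply: eq_bigr => j jI /=.
rewrite (eq_bigl (mem (I :\ j))); last first.
  by move=> i; rewrite /= !inE jI andbT andbC eq_sym.
rewrite (bigID (fun i => a j (s i))) /=.
have degS : degree a I s j = (degree a (I :\ j) s j).+1.
  by rewrite (degreeD1 s j jI) as_.
set d := degree a (I :\ j) s j in degS *.
rewrite (eq_bigr (fun=> mean_ln R d)); last first.
  move=> i /andP[/setD1P[_ iI] aji].
  by have := degreeD1 s j iI; rewrite aji degS => -[->].
rewrite [X in _ + (_ + X)](eq_bigr (fun=> mean_ln R d.+1)); last first.
  move=> i /andP[/setD1P[_ iI] /negbTE aji].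
  by have := degreeD1 s j iI; rewrite aji degS => ->.
have card1 : #|[pred i in I :\ j | a j (s i)]| = d.
  by apply: eq_card => i; rewrite !inE.
have cardI : #|I| = (d.+1 + #|[pred i in I :\ j | ~~ a j (s i)]|)%N.
  rewrite (cardsD1 j) jI add1n addSn.
  rewrite -(cardID (fun i => a j (s i)) (mem (I :\ j))).
  congr (_ + _).+1; last by apply: eq_card => i; rewrite !inE andbC.
  by rewrite -card1; apply: eq_card => i; rewrite !inE.
rewrite !sumr_const card1 degS cardI natrD mulrDl.
rewrite -[mean_ln R d *+ _]mulr_natl -[mean_ln R d.+1 *+ _]mulr_natl.
by rewrite mulr_mean_lnS addrA [ln _ + _]addrC.
Qed.

(** Bregman's theorem for the minor given by [I] and [s0], by Schrijver's
    argument; the hypothesis only says that the minor has a perfect matching,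
    since [s0] can be replaced by any permutation that agrees with it outside
    [I]. *)
Lemma ln_card_matchings (R : realType) I s0 : s0 \in matchings a I s0 ->
  ln #|matchings a I s0|%:R <= \sum_(i in I) mean_ln R (degree a I s0 i).
Proof.
have [m] := ubnP #|I|; elim: m => // m IHm in I s0 *; rewrite ltnS => leIm s0M.
have [I0|[i0 i0I]] := set_0Vmem I.
  have -> : matchings a I s0 = [set s0].
    apply/setP => s; rewrite I0 finset.in_set1; apply/matchingsP/eqP => [[_ eq_s]|->].
      by apply/permP => x; rewrite eq_s ?inE.
    by split=> // x; rewrite inE.
  by rewrite cards1 ln1 I0 big_set0.
set S := matchings a I s0; set N : R := #|S|%:R.
have N_gt0 : 0 < N by rewrite ltr0n; apply/card_gt0P; exists s0.
have I_gt0 : 0 < #|I|%:R :> R by rewrite ltr0n; apply/card_gt0P; exists i0.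
rewrite -(ler_pM2l I_gt0) -(ler_pM2l N_gt0) mulrCA.
(* Expansion along row [i], with the induction hypothesis for its minors. *)
have expand i : i \in I -> N * ln N <=
    \sum_(s in S) (ln (degree a I s i)%:R
                   + \sum_(j in I :\ i) mean_ln R (degree a (I :\ i) s j)).
  move=> iI; rewrite big_split /=.
  rewrite (eq_bigr (fun=> ln (degree a I s0 i)%:R)); last first.
    by move=> s /degree_matchings ->.
  rewrite sumr_const -[ln _ *+ _]mulr_natl degree_imset.
  apply: le_trans (card_ln_fibers R (K := [set z in s0 @: I | a i z])
                     (f := fun s : {perm T} => s i) _) _.
    move=> s sS; rewrite inE -(matchings_imset sS) imset_f //=.
    by case/matchingsP: sS => ->.
  rewrite lerD2l; apply: ler_sum => s sS.
  rewrite (matchings_fiber iI sS); apply: IHm.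
    by apply: leq_trans leIm; rewrite [#|I|](cardsD1 i) iI.
  have /matchingsP[as_ _] := sS.
  by apply/matchingsP; split=> // x /setD1P[_ /as_].
rewrite [leLHS]mulr_natl -sumr_const.
apply: le_trans (ler_sum _ expand) _.
rewrite exchange_big mulr_natl -sumr_const /=.
apply: ler_sum => s sS.
rewrite (mean_ln_minors R (matchings_refl sS)) ler_pM2l //.
by apply: ler_sum => j _; rewrite (degree_matchings j sS).
Qed.
End Matchings.

(** * Permanents and the alpha-logarithm *)

Lemma ln_le_alpha_ln (R : realType) (alpha x : R) :
  alpha < 1 -> 0 < x -> ln x <= alpha_ln alpha x.
Proof.
move=> alpha_lt1 x_gt0; rewrite /alpha_ln ler_pdivlMr ?subr_gt0 //.
by rewrite lerBrDl mulrC /powR gt_eqF // expR_ge1Dx.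
Qed.

Lemma permanent_card (R : comPzRingType) (n : nat) (A : 'M[R]_n) :
  (forall i j, A i j = 0 \/ A i j = 1) ->
  permanent A =
  #|matchings (fun i j => A i j == 1) [set: 'I_n] 1%g|%:R.
Proof.
move=> A01; rewrite /permanent -sum1_card natr_sum [RHS]big_mkcond /=.
apply: eq_bigr => s _; case: ifPn => [/matchingsP[As _]|].
  by rewrite big1 // => i _; apply/eqP/As; rewrite inE.
rewrite inE negb_forall => /existsP[i]; rewrite inE => Ai.
rewrite (bigD1 i) //=; have [->|Ai1] := A01 i (s i); first by rewrite mul0r.
by rewrite Ai1 eqxx in Ai.
Qed.

Theorem proposition10 (R : realType) (n : nat) (A : 'M[R]_n)
    (A01 : forall i j : 'I_n, A i j = 0 \/ A i j = 1)
    (perA : permanent A <> 0)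
    (rA : forall i : 'I_n, row_ones A i <> 0%N)
    (alpha : R) (alpha_gt0 : 0 < alpha) (alpha_lt1 : alpha < 1) :
  - alpha_ln alpha (1 / permanent A) <=
    \sum_(i < n) 1 / (row_ones A i)%:R *
      \sum_(1 <= j < (row_ones A i).+1) alpha_ln alpha j%:R.
Proof.
rewrite (permanent_card A01) in perA *.
set a : rel 'I_n := fun i j => A i j == 1.
set S := matchings a _ _ in perA *.
have [S0|[s sS]] := set_0Vmem S; first by rewrite S0 cards0 in perA.
have S_gt0 : 0 < #|S|%:R :> R by rewrite ltr0n; apply/card_gt0P; exists s.
apply: (@le_trans _ _ (ln #|S|%:R)).
  (* [- ln] of [#|S|] is [ln] of its inverse: the comparison serves both sides. *)
  rewrite lerNl -lnV ?posrE // div1r.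
  by apply: ln_le_alpha_ln; rewrite ?invr_gt0.
(* With no frozen row, the reference permutation does not matter. *)
have -> : S = matchings a [set: 'I_n] s.
  by apply/setP => t; rewrite !inE; apply: eq_forallb => i; rewrite inE.
apply: le_trans (ln_card_matchings R (matchings_refl sS)) _.
rewrite (eq_bigl predT); last by move=> i; rewrite inE.
apply: ler_sum => i _.
have -> : degree a [set: 'I_n] s i = row_ones A i.
  rewrite /row_ones degree_imset; apply: eq_card => j; rewrite !inE.
  by rewrite -preim_permV !inE.
apply: ler_wpM2l; first by rewrite divr_ge0.
rewrite !big_seq; apply: ler_sum => j; rewrite mem_index_iota => /andP[j_gt0 _].
by apply: ln_le_alpha_ln; rewrite ?ltr0n.
Qed.
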